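(* Let $\Omega\subseteq\mathbb{R}^n$ be a thick open set and $h\in L^1(\mathbb{R}^n)$ a shape function satisfying: $h(x)\ge 0$ for all $x\in\mathbb{R}^n$; $h(Ox)=h(x)$ for all $x\in\mathbb{R}^n$ and all orthogonal matrices $O\in\mathbb{R}^{n\times n}$; $\|h\|_{L^1(\mathbb{R}^n)}=1$; and $h$ is radially decreasing, i.e. $h(y)\le h(x)$ whenever $\|x\|\le\|y\|$. Then, for every $p\in(1,\infty]$ there exists $\tilde A>0$ such that for every $f\in L^p(\Omega)$, $$\|M^\Omega_h f\|_{L^p(\Omega)}\le\tilde A\,\|f\|_{L^p(\Omega)}.$$
   Context: $|\cdot|$ of a set is Lebesgue measure and $B_\epsilon(x)$ is the open Euclidean ball of radius $\epsilon$ centered at $x$. A Lebesgue-measurable set $\Omega\subseteq\mathbb{R}^n$ is thick if there exist $c,\epsilon_0>0$ such that $|B_\epsilon(x)\cap\Omega|>c\,|B_\epsilon(x)|$ for all $\epsilon\in(0,\epsilon_0)$ and all $x\in\Omega$. Here $\epsilon_0>0$ is fixed, chosen according to this definition for the given $\Omega$. For $\epsilon>0$ set $h_\epsilon(x)=\epsilon^{-n}h(x/\epsilon)$, $k_\epsilon(x,y)=h_\epsilon(y-x)$, $d_\epsilon(x)=\int_\Omega k_\epsilon(x,y)\,dy$, and $p_\epsilon(x,y)=k_\epsilon(x,y)/d_\epsilon(x)$ for $x,y\in\Omega$. The Markovian local maximal function on $\Omega$ is $$M^\Omega_h f(x)=\sup_{0<\epsilon<\epsilon_0}\left|\int_\Omega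 p_\epsilon(x,y)f(y)\,dy\right|,\qquad x\in\Omega.$$ *)

(* Defs.v *)
From HB Require Import structures.
From mathcomp Require Import all_boot all_order all_algebra.
From mathcomp Require Import all_classical all_reals all_analysis.

Set Implicit Arguments.
Unset Strict Implicit.
Unset Printing Implicit Defensive.

Import Order.TTheory GRing.Theory Num.Theory.
Import numFieldNormedType.Exports.

Local Open Scope classical_set_scope.
Local Open Scope ring_scope.

(* R^d with d = n.+1 >= 1 is the space of column vectors 'cV[R]_n.+1, with its
   library topology.  MathComp-Analysis only has Lebesgue measure on R, so we
   build the d-dimensional one from coverings by half-open boxes: its
   sigma-algebra is that of the Caratheodory-measurable sets, i.e. the
   Lebesgue-measurable sets. *)
Section lebesgue_measure_Rn.
Context {R : realType} {n : nat}.
Local Notation V := 'cV[R]_n.+1.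
Local Open Scope ereal_scope.

Definition box (ab : V * V) : set V :=
  [set x | forall i, (ab.1 i 0 < x i 0 <= ab.2 i 0)%R].

Definition box_vol (ab : V * V) : \bar R :=
  (\prod_i Num.max 0 (ab.2 i 0 - ab.1 i 0))%:E.

Definition lebesgue_outer (X : set V) : \bar R :=
  ereal_inf [set \sum_(k <oo) box_vol (B k) |
             B in [set B : (V * V)^nat | X `<=` \bigcup_k box (B k)]].

Lemma box_vol_ge0 ab : 0 <= box_vol ab.
Proof. by rewrite lee_fin; apply: prodr_ge0 => i _; rewrite le_max lexx. Qed.

Lemma lebesgue_outer_ge0 X : 0 <= lebesgue_outer X.
Proof.
apply: le_ereal_inf_tmp => _ [B _ <-].
by apply: nneseries_ge0 => k _ _; exact: box_vol_ge0.
Qed.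

Lemma lebesgue_outer0 : lebesgue_outer set0 = 0.
Proof.
apply/eqP; rewrite eq_le lebesgue_outer_ge0 andbT.
apply: ereal_inf_lbound; exists (fun=> (0%R, 0%R)); first exact: sub0set.
apply: eseries0 => k _ _.
by rewrite /box_vol big_ord_recl /= subrr maxxx mul0r.
Qed.

Lemma le_lebesgue_outer : {homo lebesgue_outer : A B / A `<=` B >-> A <= B}.
Proof.
move=> A B AB; apply/ereal_inf_le_tmp => x [C BC <-].
by exists C => //; exact: subset_trans BC.
Qed.

Lemma lebesgue_outer_sigma_subadditive : sigma_subadditive lebesgue_outer.
Proof.
move=> A; have [[i ioo]|] := pselect (exists i, lebesgue_outer (A i) = +oo).
  rewrite (eseries_pinfty _ _ ioo) ?leey// => k _.
  by rewrite -ltNye (lt_le_trans _ (lebesgue_outer_ge0 _)).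
rewrite -forallNE => Aoo.
apply/lee_addgt0Pr => _/posnumP[e].
rewrite (le_trans _ (epsilon_trick _ _ _))//; last first.
  by move=> k; exact: lebesgue_outer_ge0.
pose P k (B : (V * V)^nat) := A k `<=` \bigcup_j box (B j) /\
  \sum_(j <oo) box_vol (B j)
    <= lebesgue_outer (A k) + (e%:num / (2 ^ k.+1)%:R)%:E.
have [G PG] : {G : ((V * V)^nat)^nat & forall k, P k (G k)}.
  apply: (@choice _ _ P) => k.
  have ek : (0 < e%:num / (2 ^ k.+1)%:R)%R by [].
  have fin : lebesgue_outer (A k) \is a fin_num.
    by rewrite ge0_fin_numE ?lebesgue_outer_ge0// ltey; apply/eqP/Aoo.
  have := lb_ereal_inf_adherent ek fin.
  by move=> [_ [B AB <-] Bk]; exists B; split => //; exact/ltW.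
have vG_ge0 x : 0 <= (box_vol \o uncurry G) x by exact: box_vol_ge0.
apply: (@le_trans _ _ (\esum_(i in setT) (box_vol \o uncurry G) i)).
  apply: ereal_inf_lbound => /=.
  have /card_esym/ppcard_eqP[f] := card_nat2.
  exists (uncurry G \o f).
    move=> t [i _ /(PG i).1[j _ Gt]].
    by exists (f^-1%FUN (i, j)) => //=; rewrite invK ?inE.
  rewrite -(esum_pred_image (box_vol \o uncurry G) _ xpredT) ?[fun=> _]set_true//.
  by rewrite image_eq.
rewrite (_ : esum _ _ = \sum_(i <oo) \sum_(j <oo) box_vol (G i j)); last first.
  pose J : nat -> set (nat * nat) := fun i => [set (i, j) | j in setT].
  rewrite (_ : setT = \bigcup_k J k); last first.
    by rewrite predeqE => -[a b]; split => // _; exists a => //; exists b.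
  rewrite esum_bigcupT /=; last 2 first.
    - apply/trivIsetP => i j _ _ ij.
      rewrite predeqE => -[a b] /=; split => //= -[] [_] _ [<-{a} _].
      by move=> [m' _] [] /esym/eqP; rewrite (negbTE ij).
    - by move=> x; exact: vG_ge0.
  rewrite -(image_id [set: nat]) -fun_true esum_pred_image//; last first.
    by move=> k _; apply: esum_ge0 => x _; exact: vG_ge0.
  apply: eq_eseriesr => /= j _.
  rewrite -(esum_pred_image (box_vol \o uncurry G) (pair j) predT)//=; first last.
  - by move=> ? ? _ _; exact: (@can_inj _ _ _ snd).
  - by move=> k _; exact: box_vol_ge0.
  by congr esum; rewrite predeqE => -[a b]; split; move=> [i _ <-]; exists i.
apply: lee_nneseries => [k _ _|k _]; last exact: (PG k).2.
by apply: nneseries_ge0 => j _ _; exact: box_vol_ge0.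
Qed.

HB.instance Definition _ := isOuterMeasure.Build R V lebesgue_outer
  lebesgue_outer0 lebesgue_outer_ge0 le_lebesgue_outer
  lebesgue_outer_sigma_subadditive.

End lebesgue_measure_Rn.

Definition lebesgue_outer_measure (R : realType) (n : nat) :
  {outer_measure set 'cV[R]_n.+1 -> \bar R} := @lebesgue_outer R n.

(* [Rn R n] is 'cV[R]_n.+1 equipped with the Lebesgue sigma-algebra. *)
Notation Rn R n := (caratheodory_type (lebesgue_outer_measure R n)).

Definition leb (R : realType) (n : nat) : {measure set (Rn R n) -> \bar R} :=
  lebesgue_outer_measure R n : set (Rn R n) -> \bar R.
Arguments leb {R n}.

Section markovian_maximal_function.
Context {R : realType} {n : nat}.
Local Notation V := 'cV[R]_n.+1.
Implicit Types (x y : V) (h f : V -> R) (Omega : set V).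

(* The library norm on matrices is the sup norm. *)
Definition enorm x : R := Num.sqrt (\sum_i x i 0 ^+ 2).

Definition eball (x : V) (e : R) : set V := [set y | enorm (y - x) < e].

Definition thick_scale Omega (eps0 : R) : Prop :=
  0 < eps0 /\
  exists2 c : R, 0 < c & forall e x, 0 < e < eps0 -> Omega x ->
    (c%:E * leb (eball x e) < leb (eball x e `&` Omega))%E.

Definition thick Omega : Prop :=
  measurable (Omega : set (Rn R n)) /\ exists eps0, thick_scale Omega eps0.

Definition dilate h (e : R) x : R := e ^- n.+1 * h (e^-1 *: x).

Definition kern h (e : R) x y : R := dilate h e (y - x).

Definition mass h Omega (e : R) x : R :=
  \int[leb]_(y in (Omega : set (Rn R n))) kern h e x y.

Definition markov_kern h Omega (e : R) x y : R :=
  kern h e x y / mass h Omega e x.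

Definition maximal_fun h Omega (eps0 : R) f x : \bar R :=
  ereal_sup [set `| \int[leb]_(y in (Omega : set (Rn R n)))
                      (markov_kern h Omega e x y * f y)%:E |%E
            | e in [set e : R | 0 < e < eps0]].

(* As for integrals over a subset in the library, the norm of L^p(Omega) is
   the norm of the extension by zero outside Omega. *)
Definition Lnorm_on Omega (p : \bar R) (g : V -> \bar R) : \bar R :=
  'N[@leb R n]_p[g \_ Omega].

Definition Lspace_on Omega (p : \bar R) : set (V -> R) :=
  [set f | f \_ Omega \in Lfun (@leb R n) p].

End markovian_maximal_function.

(* Main.v *)
Require Import Defs.
From mathcomp Require Import all_boot all_order all_algebra.
From mathcomp Require Import all_classical all_reals all_analysis.
From mathcomp Require Import measurable_realfun ess_sup_inf ring lra.

Set Implicit Arguments.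
Unset Strict Implicit.
Unset Printing Implicit Defensive.

Import Order.TTheory GRing.Theory Num.Theory.
Import numFieldNormedType.Exports.

Local Open Scope classical_set_scope.
Local Open Scope ring_scope.

(** The maximal function on [Omega] is dominated pointwise by a Hardy-Littlewood
    maximal function on the whole space, for which the L^p bound is classical.

    Domination.  Thickness bounds the mass from below: [h] is at least some
    [a > 0] on a ball of radius [r <= 1], so [mass h Omega e x] is at least
    [e ^- n.+1 * a] times the measure of [eball x (r * e) `&` Omega], which is at
    least a fixed multiple of [e ^+ n.+1] ([mass_inv_le]).  On the other side, a
    radially decreasing [h] is at most a combination of indicators of the
    balls of radius [2 ^+ k], with weights whose sum against the volumes of these
    balls is at most a constant times the integral of [h] over the dyadic shells,
    plus one finite term ([shell_sum_lty]).  Hence every average against the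
    Markovian kernel is at most a constant times the maximal function
    ([kern_integral_le]).

    Maximal inequality.  The maximal function is taken over cubes, that is
    sup-norm balls, with rational data: there are countably many of them, so it
    is measurable, and every cube lies in a rational cube of comparable size
    ([integral_cube_le_maximal]).  The Vitali covering argument for finitely many
    cubes ([vitali_cubes]), followed by a limit, gives the weak type
    inequality ([rat_maximal_weak_type]), and summing it over dyadic levels gives
    the L^p inequality for finite [p] ([weak_type_integral_poweR], the
    Marcinkiewicz argument).  For [p = +oo] averages are at most the essential
    supremum ([rat_maximal_ae_le]).

    About the measure, only three facts are needed: half-spaces are Caratheodory
    measurable, a cube of side [2 * r] has measure at most [(2 * r) ^+ n.+1], and
    balls scale exactly ([leb_eball]).  The exact volume of a box plays no role:
    when [Omega] is nonempty, thickness itself forces the unit ball to have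
    positive measure. *)

(** * Integrals and norms of possibly non-measurable functions *)

Section lower_integral.
Local Open Scope ereal_scope.
Context {d : measure_display} {T : measurableType d} {R : realType}.
Context (mu : {measure set T -> \bar R}).

(** The integral of a nonnegative function is a supremum over the simple
    functions below it, so it is monotone without measurability.  This is what
    allows the maximal function on [Omega], a supremum over uncountably many
    scales, to be compared with a measurable one. *)
Lemma le_integral_nonmeas (D : set T) (f g : T -> \bar R) :
  (forall x, D x -> 0 <= f x) -> (forall x, D x -> f x <= g x) ->
  \int[mu]_(x in D) f x <= \int[mu]_(x in D) g x.
Proof.
move=> f0 fg.
have g0 x : D x -> 0 <= g x by move=> Dx; exact: le_trans (f0 _ Dx) (fg _ Dx).
rewrite !ge0_integralE//; apply: ereal_sup_le => _ [k kf <-].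
by exists k => // x; exact: le_trans (kf x) (lee_restrict fg x).
Qed.

Lemma abse_sub_le (a b c : \bar R) :
  0 <= a <= c -> 0 <= b <= c -> `|a - b| <= c.
Proof.
case: c => [c||]; last 2 first.
- by move=> _ _; rewrite leey.
- by move=> /andP[a0 /(le_trans a0)]; rewrite leNgt ltNy0.
case: a => [a||]; last 2 first.
- by move=> /andP[_]; rewrite leye_eq.
- by move=> /andP[]; rewrite leeNy_eq.
case: b => [b||]; last 2 first.
- by move=> _ /andP[_]; rewrite leye_eq.
- by move=> _ /andP[]; rewrite leeNy_eq.
rewrite -EFinB abse_EFin !lee_fin => /andP[a0 ac] /andP[b0 bc].
by rewrite ler_norml; apply/andP; split; lra.
Qed.

Lemma abse_integral_le (D : set T) (f g : T -> \bar R) :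
  (forall x, D x -> `|f x| <= g x) ->
  `|\int[mu]_(x in D) f x| <= \int[mu]_(x in D) g x.
Proof.
move=> fg; rewrite integralE.
apply: abse_sub_le; apply/andP; split; try by apply: integral_ge0.
- apply: le_integral_nonmeas => x Dx//; apply: le_trans (fg _ Dx).
  by rewrite funeposE ge_max lee_abs abse_ge0.
- apply: le_integral_nonmeas => x Dx//; apply: le_trans (fg _ Dx).
  by rewrite funenegE ge_max -[leRHS]abseN lee_abs abse_ge0.
Qed.

Lemma le_Lnorm_nonmeas (p : \bar R) (f g : T -> \bar R) : 1 <= p ->
  (forall x, `|f x| <= `|g x|) -> 'N[mu]_p[f] <= 'N[mu]_p[g].
Proof.
move=> p1 fg; rewrite unlock; case: p p1 => [p p1||//]; last first.
  move=> _; case: ifPn => // _; apply: le_ess_sup.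
  by apply/nearW => x /=; exact: fg.
have p0 : (0 <= p)%R by rewrite (le_trans ler01).
apply: gt0_ler_poweR; rewrite ?invr_ge0//.
- by rewrite in_itv/= leey andbT; apply: integral_ge0 => x _; exact: poweR_ge0.
- by rewrite in_itv/= leey andbT; apply: integral_ge0 => x _; exact: poweR_ge0.
- apply: le_integral_nonmeas => x _; first exact: poweR_ge0.
  by apply: gt0_ler_poweR => //; rewrite in_itv/= leey andbT abse_ge0.
Qed.

(** Continuity from below, as a bound: it is enough to bound finite unions. *)
Lemma measure_bigcup_le (E : (set T)^nat) (B : \bar R) :
  (forall k, measurable (E k)) ->
  (forall m, mu (\bigcup_(k < m) E k) <= B) -> mu (\bigcup_k E k) <= B.
Proof.
move=> mE muE.
have -> : \bigcup_k E k = \bigcup_m \bigcup_(k < m) E k.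
  apply/seteqP; split => [x [k _ kx]|x [m _ [k _ kx]]]; last by exists k.
  by exists k.+1 => //; exists k => /=.
have mEm m : measurable (\bigcup_(k < m) E k) by exact: bigcup_measurable.
have /cvg_lim <- // : mu \o (fun m => \bigcup_(k < m) E k) @ \oo -->
    mu (\bigcup_m \bigcup_(k < m) E k).
  apply: nondecreasing_cvg_mu => //; first exact: bigcupT_measurable.
  move=> a b ab; apply/subsetPset => x [k /= ka kx]; exists k => //=.
  exact: leq_trans ab.
apply: lime_le; last exact: nearW.
apply: ereal_nondecreasing_is_cvgn => a b ab.
apply: le_measure; [exact/mem_set/mEm|exact/mem_set/mEm|].
by move=> x [k /= ka kx]; exists k => //=; exact: leq_trans ab.
Qed.

Lemma measurable_above_level (phi : T -> R) (l : R) : measurable_fun setT phi ->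
  measurable_fun setT (fun x => (if l < 2 * phi x then phi x else 0)%R).
Proof.
move=> mphi; apply: measurable_fun_ifT => //.
by apply: measurable_fun_ltr => //; exact: measurable_funM.
Qed.

Lemma Lnorm_scale_le (g : T -> \bar R) (phi : T -> R) (A C p : R) :
  (0 <= A)%R -> (0 <= C)%R -> (1 < p)%R ->
  measurable_fun setT g -> (forall x, 0 <= g x) -> (forall x, 0 <= phi x)%R ->
  \int[mu]_x (g x `^ p) <= C%:E * \int[mu]_x ((phi x) `^ p)%:E ->
  'N[mu]_p%:E[(fun x => A%:E * g x)] <=
    ((A `^ p * C) `^ p^-1)%:E * 'N[mu]_p%:E[EFin \o phi].
Proof.
move=> A0 C0 p1 mg g0 phi0 gphi.
have p0 : (0 < p)%R by rewrite (lt_trans ltr01).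
have AC0 : (0 <= A `^ p * C)%R by rewrite mulr_ge0// powR_ge0.
have phiE : \int[mu]_x (`|(EFin \o phi) x| `^ p) = \int[mu]_x ((phi x) `^ p)%:E.
  by apply: eq_integral => x _ /=; rewrite ger0_norm.
have phiI0 : 0 <= \int[mu]_x ((phi x) `^ p)%:E.
  by apply: integral_ge0 => x _; rewrite lee_fin powR_ge0.
have mgp : measurable_fun setT (fun x => g x `^ p).
  exact: (measurableT_comp (measurable_poweR p) mg).
rewrite unlock /= phiE -poweR_EFin -poweRM ?lee_fin//.
apply: gt0_ler_poweR; first by rewrite invr_ge0 ltW.
- rewrite in_itv/= leey andbT; apply: integral_ge0 => x _; exact: poweR_ge0.
- by rewrite in_itv/= leey andbT mule_ge0// lee_fin.
have -> : \int[mu]_x (`|A%:E * g x| `^ p) = (A `^ p)%:E * \int[mu]_x (g x `^ p).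
  rewrite -ge0_integralZl//; last 2 first.
  - by move=> x _; exact: poweR_ge0.
  - by rewrite lee_fin powR_ge0.
  apply: eq_integral => x _; rewrite gee0_abs; last by rewrite mule_ge0// lee_fin.
  by rewrite poweRM// lee_fin.
by rewrite EFinM -muleA lee_wpmul2l// lee_fin powR_ge0.
Qed.

End lower_integral.

(** * From a weak type inequality to the L^p inequality *)

Section interpolation.
Context {R : realType}.

Lemma exp2_unbounded (x : R) : exists j, x < 2 ^+ j.
Proof.
exists (Num.bound `|x|); rewrite (le_lt_trans (ler_norm x))//.
rewrite (lt_trans (archi_boundP (normr_ge0 x)))// -natrX ltr_nat ltn_expl//.
Qed.

Lemma half_powR_lt1 (r : R) : 0 < r -> 2^-1 `^ r < 1.
Proof.
move=> r0; have := @gt0_ltr_powR R _ r0 2^-1 1; rewrite powR1; apply.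
- by rewrite nnegrE invr_ge0.
- by rewrite nnegrE.
- by rewrite invf_lt1// ltr1n.
Qed.

(** The terms below [t] of a decreasing geometric sequence sum up to at most a
    constant multiple of [t], whatever the first term is. *)
Lemma sum_geometric_below (a q t : R) (m : nat) : 0 <= a -> 0 <= q < 1 -> 0 <= t ->
  \sum_(j < m) (if a * q ^+ j < t then a * q ^+ j else 0) <= t / (1 - q).
Proof.
move=> a0 /andP[q0 q1] t0.
have q1' : 0 < 1 - q by rewrite subr_gt0.
elim: m a a0 => [|m IHm] a a0; first by rewrite big_ord0 divr_ge0// ltW.
have [at_|ta] := ltP a t.
  apply: (@le_trans _ _ (\sum_(j < m.+1) a * q ^+ j)).
    by apply: ler_sum => j _; case: ifP => // _; rewrite mulr_ge0// exprn_ge0.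
  rewrite -mulr_sumr ler_pdivlMr// -mulrA [X in _ * X]mulrC -[1 - q]opprB mulNr.
  rewrite -subrX1 opprB -[leRHS]mulr1 ler_pM//; last by rewrite gerBl exprn_ge0.
    by rewrite subr_ge0 exprn_ile1// ltW.
  exact: ltW.
rewrite big_ord_recl expr0 mulr1 ltNge ta/= add0r.
under eq_bigr => j _ do rewrite /bump leq0n add1n exprS mulrA.
by apply: IHm; rewrite mulr_ge0.
Qed.

Local Open Scope ereal_scope.
Context {d : measure_display} {T : measurableType d}.
Context (mu : {measure set T -> \bar R}).
Import HBNNSimple.

(** The levels are [A / 2 ^+ j.+1]; the level found is the largest one whose
    [p]-th power is below [h]. *)
Lemma dyadic_level (p A h : R) (g : \bar R) : (1 < p)%R -> (0 < A)%R ->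
  (0 < h <= A `^ p)%R -> 0 <= g -> h%:E <= g `^ p ->
  exists j, (A / 2 ^+ j.+1)%:E < g /\ (h <= (2 * (A / 2 ^+ j.+1)) `^ p)%R.
Proof.
move=> p1 A0 /andP[h0 hA] g0 hg.
have p0 : (0 < p)%R by rewrite (lt_trans ltr01).
have lam0 j : (0 < A / 2 ^+ j.+1)%R by rewrite divr_gt0// exprn_gt0.
pose P j := ((A / 2 ^+ j.+1) `^ p < h)%R.
have exP : exists j, P j.
  have [j hj] := exp2_unbounded (A `^ p / h)%R.
  exists j; rewrite /P powRM ?(ltW A0) ?invr_ge0 ?exprn_ge0//.
  rewrite (@le_lt_trans _ _ (A `^ p / 2 ^+ j.+1)%R)//.
    rewrite ler_wpM2l ?powR_ge0//; apply: ge1r_powR => //; last exact: ltW.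
    by rewrite invr_gt0 exprn_gt0//= invf_le1 ?exprn_gt0// exprn_ege1// ler1n.
  rewrite ltr_pdivrMr ?exprn_gt0// mulrC -ltr_pdivrMr//.
  by rewrite (lt_le_trans hj)// ler_eXn2l ?ltr1n.
exists (ex_minn exP); case: ex_minnP => j Pj jmin; split.
  rewrite ltNge; apply/negP => gj.
  suff : h%:E <= ((A / 2 ^+ j.+1) `^ p)%:E by rewrite lee_fin leNgt -/(P j) Pj.
  rewrite (le_trans hg)// -poweR_EFin; apply: gt0_ler_poweR => //; first exact: ltW.
    by rewrite in_itv/= leey andbT.
  by rewrite in_itv/= leey andbT lee_fin ltW.
case: j Pj jmin => [|j] _ jmin; first by rewrite expr1 mulrCA divff ?mulr1.
rewrite leNgt; apply/negP => hj.
suff /jmin : P j by rewrite ltnn.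
rewrite /P (le_lt_trans _ hj)//.
suff -> : (A / 2 ^+ j.+1 = 2 * (A / 2 ^+ j.+2))%R by [].
by rewrite [in RHS]exprS; field; rewrite expf_neq0.
Qed.

(** The Marcinkiewicz argument.  The weak type hypothesis only involves the part
    of [phi] above half of the level, and interpolates between the L^1 and the
    L^oo endpoints. *)
Lemma weak_type_integral_poweR (p C : R) (phi : T -> R) (g : T -> \bar R) :
  (1 < p)%R -> (0 <= C)%R ->
  measurable_fun setT phi -> (forall x, 0 <= phi x)%R ->
  measurable_fun setT g -> (forall x, 0 <= g x) ->
  (forall l : R, (0 < l)%R -> mu [set x | l%:E < g x] <=
     (C / l)%:E * \int[mu]_x (if l < 2 * phi x then phi x else 0)%:E) ->
  \int[mu]_x (g x `^ p) <=
    (C * 2 `^ p * (2 `^ (p - 1) / (1 - 2^-1 `^ (p - 1))))%:E *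
    \int[mu]_x ((phi x) `^ p)%:E.
Proof.
move=> p1 C0 mphi phi0 mg g0 weak.
have p0 : (0 < p)%R by rewrite (lt_trans ltr01).
have pm0 : (0 < p - 1)%R by rewrite subr_gt0.
have q0 : (0 <= (2^-1 : R) `^ (p - 1))%R by exact: powR_ge0.
have q1 : ((2^-1 : R) `^ (p - 1) < 1)%R by exact: half_powR_lt1.
set K := (X in X%:E * _).
have K0 : (0 <= K)%R.
  by rewrite /K !mulr_ge0 ?powR_ge0// invr_ge0 subr_ge0 ltW.
rewrite ge0_integralTE; last by move=> x; exact: poweR_ge0.
apply: ge_ereal_sup => _ [h hg <-].
(* A simple function [h] below [g `^ p] is bounded by some [A `^ p], so that the
   dyadic levels can be indexed downwards from [A / 2]. *)
have [B [_ /(_ _ (ltr_pwDr ltr01 (lexx _)))]] := simple_bounded h.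
move=> /= hB.
set A := Num.max 1%R (B + 1)%R.
have A1 : (1 <= A)%R by rewrite le_max lexx.
have A0 : (0 < A)%R by rewrite (lt_le_trans ltr01).
have hA x : (h x <= A `^ p)%R.
  rewrite (@le_trans _ _ A)//; last by apply: le1r_powR => //; exact: ltW.
  by rewrite le_max; apply/orP; right; rewrite (le_trans (ler_norm _))// hB.
pose lam j : R := (A / 2 ^+ j.+1)%R.
have lam0 j : (0 < lam j)%R by rewrite divr_gt0// exprn_gt0.
pose E j := [set x | (lam j)%:E < g x].
have mE j : measurable (E j).
  rewrite -[X in measurable X]setTI; exact: emeasurable_fun_o_infty.
have mF l : measurable_fun setT (fun x => (if l < 2 * phi x then phi x else 0)%:E).
  exact/measurable_EFinP/measurable_above_level.
have F0 (l : R) x : 0 <= (if (l < 2 * phi x)%R then phi x else 0%R)%:E.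
  by rewrite lee_fin; case: ifP.
rewrite -integralT_nnsfun.
apply: (@le_trans _ _ (\int[mu]_x
   \sum_(j <oo) ((2 * lam j) `^ p * \1_(E j) x)%:E)).
  apply: le_integral_nonmeas => x _ /=; first by rewrite lee_fin.
  have [hx|hx] := ltP 0%R (h x); last first.
    rewrite (@le_trans _ _ 0)//; apply: nneseries_ge0 => j _ _.
    by rewrite lee_fin mulr_ge0// powR_ge0.
  have [|j [gj hj]] := dyadic_level p1 A0 _ (g0 x) (hg x); first by rewrite hx hA.
  rewrite (@nneseriesD1 _ _ j)//; last first.
    by move=> i _; rewrite lee_fin mulr_ge0// powR_ge0.
  rewrite -[leLHS]adde0; apply: leeD.
    by rewrite indicE mem_set//= mulr1 lee_fin.
  by apply: nneseries_ge0 => i _ _; rewrite lee_fin mulr_ge0// powR_ge0.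
rewrite integral_nneseries//; last 2 first.
- move=> j; apply/measurable_EFinP; apply: measurable_funM => //.
- by move=> j x _; rewrite lee_fin mulr_ge0// powR_ge0.
apply: (@le_trans _ _ (\sum_(j <oo) \int[mu]_x
   (((2 * lam j) `^ p * (C / lam j))%:E *
     (if (lam j < 2 * phi x)%R then phi x else 0%R)%:E))).
  apply: lee_nneseries => j _; first by move=> _; apply: integral_ge0 => x _;
    rewrite lee_fin mulr_ge0// powR_ge0.
  rewrite ge0_integralZl//; last first.
    by rewrite lee_fin mulr_ge0 ?powR_ge0// divr_ge0// ltW.
  under eq_integral => x _ do rewrite EFinM.
  rewrite ge0_integralZl//; last 2 first.
  - by apply/measurable_EFinP; exact: measurable_indic.
  - by rewrite lee_fin powR_ge0.
  rewrite integral_indic// setIT EFinM -muleA lee_wpmul2l ?lee_fin ?powR_ge0//.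
  exact: weak.
rewrite -integral_nneseries//; last 2 first.
- by move=> j; apply: measurable_funeM.
- move=> j x _; apply: mule_ge0 => //.
  by rewrite lee_fin mulr_ge0 ?powR_ge0// divr_ge0// ltW.
rewrite -ge0_integralZl//; last 2 first.
- apply/measurable_EFinP.
  exact: (measurableT_comp (measurable_powR p) mphi).
- by move=> x _; rewrite lee_fin powR_ge0.
apply: le_integral_nonmeas => x _.
  apply: nneseries_ge0 => j _ _; apply: mule_ge0 => //.
  by rewrite lee_fin mulr_ge0 ?powR_ge0// divr_ge0// ltW.
apply: lime_le.
  apply: is_cvg_nneseries => j _ _; apply: mule_ge0 => //.
  by rewrite lee_fin mulr_ge0 ?powR_ge0// divr_ge0// ltW.
apply: nearW => m.
under eq_bigr do rewrite -EFinM.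
rewrite sumEFin -EFinM lee_fin big_mkord.
(* Pointwise, the levels below [2 * phi x] contribute a geometric sum. *)
pose a := ((A / 2) `^ (p - 1))%R.
pose q := ((2^-1 : R) `^ (p - 1))%R.
pose t := ((2 * phi x) `^ (p - 1))%R.
have lamE j : (lam j `^ (p - 1) = a * q ^+ j)%R.
  rewrite /lam exprS invfM mulrA powRM ?divr_ge0 ?(ltW A0) ?invr_ge0 ?exprn_ge0//.
  by rewrite -exprVn -powR_mulrn ?invr_ge0// powRAC powR_mulrn.
apply: (@le_trans _ _ (\sum_(j < m) (C * 2 `^ p * phi x *
   (if a * q ^+ j < t then a * q ^+ j else 0)))%R).
  apply: ler_sum => j _; rewrite -lamE.
  have [lphi|_] := ltP; last by rewrite mulr0 !mulr_ge0 ?powR_ge0//;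
    case: ifP => // _; exact: powR_ge0.
  have -> : (lam j `^ (p - 1) < t)%R.
    apply: gt0_ltr_powR => //; rewrite nnegrE; last by rewrite mulr_ge0.
    exact: ltW.
  rewrite powRM//; last exact: ltW.
  rewrite -(mulr_powRB1 (ltW (lam0 j)))//.
  have := lam0 j; move: (lam j `^ _)%R (2 `^ p)%R (phi x) => u v w l0.
  rewrite le_eqVlt; apply/orP; left; apply/eqP; field.
  by rewrite gt_eqF.
rewrite -mulr_sumr (le_trans (ler_wpM2l _ (sum_geometric_below _ _ _ _)))//.
- by rewrite !mulr_ge0 ?powR_ge0.
- exact: powR_ge0.
- by rewrite q0 q1.
- exact: powR_ge0.
- rewrite /t powRM// /K -(mulr_powRB1 (phi0 x) p0).
  rewrite le_eqVlt; apply/orP; left; apply/eqP; rewrite /q; ring.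
Qed.

End interpolation.

(** * Lebesgue measure: boxes, cubes and balls *)

Section lebesgue_Rn.
Context {R : realType} {n : nat}.
Local Notation V := 'cV[R]_n.+1.
Implicit Types (c x y : V) (r : R) (X : set V).
Local Open Scope ereal_scope.

(** The open ball of radius [r] for the sup norm. *)
Definition cube c r : set V := [set x | forall i, (`|x i 0 - c i 0| < r)%R].

Lemma lebesgue_outer_box_le (ab : V * V) : lebesgue_outer (box ab) <= box_vol ab.
Proof.
apply: ereal_inf_lbound; exists (fun k => if k == 0%N then ab else (0%R, 0%R)).
  by move=> x abx; exists 0%N.
rewrite (@nneseriesD1 _ _ 0%N)//; last by move=> k _; exact: box_vol_ge0.
rewrite eseries0 ?adde0// => -[//|k] _ _ /=.
by rewrite /box_vol big_ord_recl /= subrr maxxx mul0r.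
Qed.

Lemma leb_cube_le c r : (0 < r)%R -> @leb R n (cube c r) <= ((2 * r) ^+ n.+1)%:E.
Proof.
move=> r0; set ab := (\col_i (c i 0 - r), \col_i (c i 0 + r))%R.
apply: (@le_trans _ _ (box_vol ab)).
  apply: le_trans (lebesgue_outer_box_le ab); apply: le_lebesgue_outer.
  move=> x cx i; rewrite !mxE; have := cx i.
  by rewrite ltr_distl => /andP[-> /ltW].
rewrite lee_fin /ab/= (eq_bigr (fun=> 2 * r)%R); last first.
  move=> i _; rewrite !mxE.
  rewrite (_ : c i 0 + r - (c i 0 - r) = 2 * r)%R; last by ring.
  by rewrite max_r// mulr_ge0// ltW.
by rewrite prodr_const card_ord.
Qed.

(** A half-space cuts a box into two boxes of the same total volume. *)
Lemma box_split (ab : V * V) (i : 'I_n.+1) (a : R) :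
  exists ab1 ab2, [/\ box ab `&` [set x | (x i 0 <= a)%R] `<=` box ab1,
    box ab `&` ~` [set x | (x i 0 <= a)%R] `<=` box ab2 &
    box_vol ab1 + box_vol ab2 = box_vol ab].
Proof.
exists (ab.1, \col_j if j == i then Num.min (ab.2 j 0) a else ab.2 j 0)%R.
exists (\col_j if j == i then Num.max (ab.1 j 0) a else ab.1 j 0, ab.2)%R.
split.
- move=> x [abx /= xa] j; rewrite !mxE.
  have /andP[-> h] /= := abx j; case: eqP => [ji|_//].
  by rewrite le_min h ji xa.
- move=> x [abx /= /negP]; rewrite -ltNge => xa j; rewrite !mxE.
  have /andP[h ->] /= := abx j; rewrite andbT; case: eqP => [ji|_//].
  by rewrite gt_max h ji xa.
- rewrite -EFinD; congr EFin.
  rewrite [X in (X + _)%R](bigD1 i)//= [X in (_ + X)%R](bigD1 i)//=.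
  rewrite [in RHS](bigD1 i)//= !mxE eqxx.
  under eq_bigr => j /negPf ji do rewrite !mxE ji.
  rewrite [X in (_ + _ * X)%R](eq_bigr (fun j => Num.max 0 (ab.2 j 0 - ab.1 j 0))%R);
    last by move=> j /negPf ji; rewrite !mxE ji.
  rewrite -mulrDl; congr (_ * _)%R.
  move: (ab.1 i 0%R) (ab.2 i 0%R) => u v.
  by rewrite /Num.min /Num.max; do ! case: ifPn; rewrite -?leNgt; lra.
Qed.

Lemma caratheodory_halfspace (i : 'I_n.+1) (a : R) :
  measurable ([set x | (x i 0 <= a)%R] : set (Rn R n)).
Proof.
apply: le_caratheodory_measurable => X.
apply: le_ereal_inf_tmp => _ [B XB <-].
pose P k (c : (V * V) * (V * V)) :=
  [/\ box (B k) `&` [set x | (x i 0 <= a)%R] `<=` box c.1,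
    box (B k) `&` ~` [set x | (x i 0 <= a)%R] `<=` box c.2 &
    box_vol c.1 + box_vol c.2 = box_vol (B k)].
have [C PC] : {C : nat -> (V * V) * (V * V) & forall k, P k (C k)}.
  apply: (@choice _ _ P) => k; have [u [v uv]] := box_split (B k) i a.
  by exists (u, v).
rewrite (eq_eseriesr (g := fun k => box_vol (C k).1 + box_vol (C k).2)); last first.
  by move=> k _; have [_ _ ->] := PC k.
rewrite nneseriesD; try by move=> k _ _; exact: box_vol_ge0.
apply: leeD; apply: ereal_inf_lbound.
- exists (fun k => (C k).1) => // x [/XB[k _ Bk] xa]; exists k => //.
  by have [+ _ _] := PC k; apply.
- exists (fun k => (C k).2) => // x [/XB[k _ Bk] xa]; exists k => //.
  by have [_ + _] := PC k; apply.
Qed.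

Lemma measurable_coord (i : 'I_n.+1) :
  measurable_fun setT (fun x : Rn R n => (x : V) i 0%R).
Proof.
apply: (measurability _ (RGenOInfty.measurableE R)) => // _ [_ [a ->] <-].
rewrite setTI (_ : _ @^-1` _ = ~` [set x : V | (x i 0 <= a)%R]).
  exact/measurableC/caratheodory_halfspace.
by apply/seteqP; split => x /=; rewrite in_itv/= andbT ltNge => /negP.
Qed.

Lemma measurable_enorm_sub c :
  measurable_fun setT (fun x : Rn R n => enorm ((x : V) - c)).
Proof.
apply: (measurableT_comp (f := @Num.sqrt R)
  (g := fun x : Rn R n => (\sum_i ((x : V) - c) i 0 ^+ 2)%R)).
  exact: (continuous_measurable_fun (@sqrt_continuous R)).
apply: measurable_sum => i; apply: measurable_funX.
rewrite [X in measurable_fun _ X](_ : _ = fun x : Rn R n => ((x : V) i 0 - c i 0)%R).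
  exact: measurable_funB (measurable_coord i) (measurable_cst _).
by apply/funext => x; rewrite !mxE.
Qed.

Lemma measurable_cube c r : measurable (cube c r : set (Rn R n)).
Proof.
rewrite [X in measurable X](_ : _ =
    \bigcap_(i in [set: 'I_n.+1]) [set x : Rn R n | (`|(x : V) i 0 - c i 0| < r)%R]).
  apply: fin_bigcap_measurable => // i _; rewrite -[X in measurable X]setTI.
  have mi : measurable_fun setT (fun x : Rn R n => `|(x : V) i 0 - c i 0|%R).
    apply: (measurableT_comp (f := @Num.norm R R)); first exact: normr_measurable.
    exact: measurable_funB (measurable_coord i) (measurable_cst _).
  rewrite (_ : [set x | _] = (fun x : Rn R n => `|(x : V) i 0 - c i 0|%R) @^-1` `]-oo, r[).
    exact: mi.
  by apply/seteqP; split => x /=; rewrite in_itv.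
by apply/seteqP; split => x /= h i; [move=> _; exact: h|exact: (h i I)].
Qed.

Lemma measurable_eball c r : measurable (eball c r : set (Rn R n)).
Proof.
rewrite -[X in measurable X]setTI.
rewrite (_ : eball c r = (fun x : Rn R n => enorm ((x : V) - c)) @^-1` `]-oo, r[).
  exact: measurable_enorm_sub.
by apply/seteqP; split => x /=; rewrite in_itv.
Qed.

Lemma enormZ (a : R) x : enorm (a *: x)%R = (`|a| * enorm x)%R.
Proof.
rewrite /enorm -sqrtr_sqr -sqrtrM ?sqr_ge0// mulr_sumr; congr Num.sqrt.
by apply: eq_bigr => i _; rewrite mxE exprMn.
Qed.

Lemma enorm_ge0 x : (0 <= enorm x)%R. Proof. exact: sqrtr_ge0. Qed.

Lemma coord_le_enorm x (i : 'I_n.+1) : (`|x i 0| <= enorm x)%R.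
Proof.
rewrite -sqrtr_sqr; apply: ler_wsqrtr; rewrite (bigD1 i)//= lerDl.
by apply: sumr_ge0 => j _; exact: sqr_ge0.
Qed.

Lemma eball_sub_cube c r : eball c r `<=` cube c r.
Proof.
move=> x; rewrite /eball/= => xr i; apply: le_lt_trans xr.
by have := coord_le_enorm (x - c)%R i; rewrite !mxE.
Qed.

Lemma lebesgue_outer_affine_le x (s : R) X : (0 < s)%R ->
  lebesgue_outer [set (x + s *: y)%R | y in X] <= (s ^+ n.+1)%:E * lebesgue_outer X.
Proof.
move=> s0.
rewrite -lee_pdivrMl ?exprn_gt0//; apply: le_ereal_inf_tmp => _ [B XB <-].
rewrite lee_pdivrMl ?exprn_gt0// -nneseriesZl; last first.
  by move=> k _; exact: box_vol_ge0.
apply: ereal_inf_lbound.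
exists (fun k => (x + s *: (B k).1, x + s *: (B k).2)%R).
  move=> _ [y /XB[k _ By] <-]; exists k => // i; rewrite !mxE.
  have /andP[h1 h2] := By i.
  by rewrite ltrD2l lerD2l ltr_pM2l// ler_pM2l// h1.
apply: eq_eseriesr => k _; rewrite -EFinM; congr EFin.
transitivity (\prod_(i < n.+1) (s * Num.max 0 ((B k).2 i 0 - (B k).1 i 0)))%R;
  last by rewrite big_split/= prodr_const card_ord.
apply: eq_bigr => i _; rewrite !mxE maxr_pMr ?(ltW s0)// mulr0.
by congr Num.max; ring.
Qed.

(** Both inequalities come from [lebesgue_outer_affine_le], applied to an affine
    map and to its inverse. *)
Lemma leb_eball x (s : R) : (0 < s)%R ->
  @leb R n (eball x s) = (s ^+ n.+1)%:E * @leb R n (eball 0%R 1%R).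
Proof.
move=> s0; apply/eqP; rewrite eq_le; apply/andP; split.
  apply: le_trans (lebesgue_outer_affine_le x _ s0); apply: le_lebesgue_outer.
  move=> y; rewrite /eball/= => ys; exists (s^-1 *: (y - x))%R.
    rewrite subr0 enormZ gtr0_norm ?invr_gt0// mulrC ltr_pdivrMr// mul1r//.
  by rewrite scalerA divff ?gt_eqF// scale1r addrC subrK.
rewrite -lee_pdivlMl ?exprn_gt0// -exprVn.
have si0 : (0 < s^-1)%R by rewrite invr_gt0.
apply: le_trans (lebesgue_outer_affine_le (- (s^-1 *: x))%R _ si0).
apply: le_lebesgue_outer => y; rewrite /eball/= subr0 => ys.
exists (x + s *: y)%R; last by rewrite scalerDr scalerA mulVf ?gt_eqF// scale1r addKr.
by rewrite addrAC subrr add0r enormZ gtr0_norm// -[ltRHS]mulr1 ltr_pM2l.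
Qed.

End lebesgue_Rn.

(** * The Hardy-Littlewood maximal function over rational cubes *)

Lemma seq_argmax {R : realType} {T : eqType} (f : T -> R) (s : seq T) : s != [::] ->
  exists2 b0, b0 \in s & forall b, b \in s -> f b <= f b0.
Proof.
elim: s => // a s IHs _; have [->|/IHs[b0 b0s hb0]] := eqVneq s [::].
  by exists a; rewrite ?mem_head// => b; rewrite inE => /eqP ->.
have [ab|ba] := leP (f a) (f b0).
  exists b0; first by rewrite inE b0s orbT.
  by move=> b; rewrite inE => /predU1P[->//|/hb0].
exists a; first exact: mem_head.
by move=> b; rewrite inE => /predU1P[->//|/hb0 /le_trans]; apply; exact: ltW.
Qed.

Section maximal_function.
Context {R : realType} {n : nat}.
Local Notation V := 'cV[R]_n.+1.
Local Notation mu := (@leb R n).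
Implicit Types (c x y : V) (r : R) (X : set V).
Local Open Scope ereal_scope.

(** The union of a list of cubes, given by their centers and radii. *)
Definition cubes (s : seq (V * R)) : set (Rn R n) :=
  \bigcup_(b in [set` s]) cube b.1 b.2.

Lemma measurable_cubes s : measurable (cubes s).
Proof. by apply: fin_bigcup_measurable => // b _; exact: measurable_cube. Qed.

Lemma cube_sub_triple (c c0 : V) (r r0 : R) : (r <= r0)%R ->
  cube c r `&` cube c0 r0 !=set0 -> cube c r `<=` cube c0 (3 * r0)%R.
Proof.
move=> rr0 [z [cz c0z]] y cy i; have := cz i; have := c0z i; have := cy i.
rewrite !ltr_distl => /andP[? ?] /andP[? ?] /andP[? ?].
by apply/andP; split; lra.
Qed.

(** The Vitali covering argument, by induction on the list: the cubes that meet
    the largest one are contained in its triple, and the induction hypothesis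
    applies to the others, whose union is disjoint from it. *)
Lemma vitali_cubes (psi : Rn R n -> R) (l : R) (s : seq (V * R)) :
  measurable_fun setT psi -> (forall x, 0 <= psi x)%R -> (0 < l)%R ->
  (forall b, b \in s -> (0 < b.2)%R /\
    (l * (2 * b.2) ^+ n.+1)%:E <= \int[mu]_(x in cube b.1 b.2) (psi x)%:E) ->
  mu (cubes s) <= (3 ^+ n.+1 / l)%:E * \int[mu]_(x in cubes s) (psi x)%:E.
Proof.
move=> mpsi psi0 l0.
have mpsiE (D : set (Rn R n)) : measurable_fun D (EFin \o psi).
  exact/measurable_funTS/measurable_EFinP.
have K0 : (0 <= 3 ^+ n.+1 / l)%R by rewrite divr_ge0 ?exprn_ge0// ltW.
have [m] := ubnP (size s); elim: m s => // m IHm s /ltnSE sm sP.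
have [s0|/(seq_argmax snd)[b0 b0s maxb0]] := eqVneq s [::].
  rewrite /cubes s0 set_nil bigcup_set0 measure0; apply: mule_ge0.
    by rewrite lee_fin.
  by apply: integral_ge0 => x _; rewrite lee_fin.
have [r0 intb0] := sP _ b0s.
pose Q0 : set (Rn R n) := cube b0.1 b0.2.
have mQ0 : measurable Q0 by exact: measurable_cube.
pose s' := [seq b <- s | `[< cube b.1 b.2 `&` cube b0.1 b0.2 = set0 >]].
have b0Q0 : Q0 b0.1 by move=> i; rewrite subrr normr0.
have s's : (size s' < size s)%N.
  rewrite size_filter ltn_neqAle count_size andbT -all_count; apply/negP.
  move=> /allP/(_ _ b0s)/asboolP; rewrite setIid => /seteqP[/(_ _ b0Q0)].
  by [].
have sub : cubes s `<=` (cube b0.1 (3 * b0.2)%R : set (Rn R n)) `|` cubes s'.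
  move=> x [b /= bs bx].
  have [bb0|/eqP/set0P bb0] := pselect (cube b.1 b.2 `&` cube b0.1 b0.2 = set0).
    by right; exists b => //=; rewrite mem_filter bs andbT; apply/asboolP.
  by left; apply: cube_sub_triple bx => //; exact: maxb0.
have IH := IHm s' (leq_trans s's sm) (fun b bs' =>
  sP b (mem_subseq (filter_subseq _ _) bs')).
have disj : [disjoint Q0 & cubes s'].
  rewrite disj_set2E; apply/eqP/seteqP; split => // x [Q0x [b /=]].
  rewrite mem_filter => /andP[/asboolP bb0 _] bx.
  have : (cube b.1 b.2 `&` cube b0.1 b0.2) x by split.
  by rewrite bb0.
have sub' : Q0 `|` cubes s' `<=` cubes s.
  move=> x [Q0x|[b /=]]; first by exists b0.
  by rewrite mem_filter => /andP[_ bs] bx; exists b.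
apply: (@le_trans _ _ (mu (cube b0.1 (3 * b0.2)%R) + mu (cubes s'))).
  apply: (le_trans (le_lebesgue_outer sub)).
  exact: (@outer_measureU2 _ _ (lebesgue_outer_measure R n)).
apply: (@le_trans _ _ ((3 ^+ n.+1 / l)%:E * \int[mu]_(x in Q0 `|` cubes s') (psi x)%:E)).
  rewrite ge0_integral_setU//; last 2 first.
  - exact: measurable_cubes.
  - by move=> x _; rewrite lee_fin.
  rewrite ge0_muleDr; last 2 first.
  - by apply: integral_ge0 => x _; rewrite lee_fin.
  - by apply: integral_ge0 => x _; rewrite lee_fin.
  apply: leeD => //; apply: le_trans (leb_cube_le _ _) _; first by rewrite mulr_gt0.
  have -> : ((2 * (3 * b0.2)) ^+ n.+1 = 3 ^+ n.+1 / l * (l * (2 * b0.2) ^+ n.+1))%R.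
    by rewrite mulrCA exprMn mulrA divfK// gt_eqF.
  by rewrite EFinM lee_wpmul2l ?lee_fin.
rewrite lee_wpmul2l ?lee_fin//; apply: ge0_subset_integral => //.
- by apply: measurableU => //; exact: measurable_cubes.
- exact: measurable_cubes.
- by move=> x _; rewrite lee_fin.
Qed.

(** An enumeration of the cubes with rational center and positive rational
    radius.  Codes that represent no such cube are sent to the unit cube. *)
Definition rat_cube (k : nat) : V * R :=
  if unpickle k is Some (q, s) then
    if (0 < s :> rat)%R then (map_mx ratr (q : 'cV[rat]_n.+1), ratr s)
    else (0, 1)%R
  else (0, 1)%R.

Lemma rat_cube_gt0 k : (0 < (rat_cube k).2)%R.
Proof.
rewrite /rat_cube; case: unpickle => [[q s]|]; last exact: ltr01.
by case: ifPn => // s0; rewrite ltr0q.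
Qed.

(** The average of [phi] over a cube, normalized by the volume
    [(2 * r) ^+ n.+1], of which only the fact that it bounds the measure of the cube
    is used. *)
Definition cube_avg (phi : V -> R) (b : V * R) : \bar R :=
  ((2 * b.2) ^- n.+1)%:E *
  \int[mu]_(y in (cube b.1 b.2 : set (Rn R n))) (phi y)%:E.

(** The uncentered maximal function over rational cubes, for nonnegative [phi].
    [esups _ 0] is the supremum of the whole sequence; the cubes that do not
    contain [x] contribute [0]. *)
Definition rat_maximal (phi : V -> R) (x : V) : \bar R :=
  esups (fun k => (\1_(cube (rat_cube k).1 (rat_cube k).2) x)%:E *
                  cube_avg phi (rat_cube k)) 0%N.

Section properties.
Context (phi : Rn R n -> R) (mphi : measurable_fun setT phi).
Context (phi0 : forall x, (0 <= phi x)%R).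

Lemma cube_avg_ge0 b : (0 < b.2)%R -> 0 <= cube_avg phi b.
Proof.
move=> b0; apply: mule_ge0.
  by rewrite lee_fin invr_ge0 exprn_ge0// mulr_ge0// ltW.
by apply: integral_ge0 => x _; rewrite lee_fin.
Qed.

Lemma measurable_rat_maximal :
  measurable_fun setT (rat_maximal phi : Rn R n -> \bar R).
Proof.
apply: (@measurable_fun_esups _ _ _ _ (fun k (x : Rn R n) =>
  (\1_(cube (rat_cube k).1 (rat_cube k).2) x)%:E * cube_avg phi (rat_cube k))).
move=> k; apply: emeasurable_funM; last exact: measurable_cst.
apply/measurable_EFinP.
by apply: measurable_indic; exact: measurable_cube.
Qed.

Lemma rat_maximal_ubound k x : cube (rat_cube k).1 (rat_cube k).2 x ->
  cube_avg phi (rat_cube k) <= rat_maximal phi x.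
Proof.
move=> kx; apply: ereal_sup_ubound; exists k => //.
by rewrite indicE mem_set// mul1e.
Qed.

Lemma rat_maximal_ge0 x : 0 <= rat_maximal phi x.
Proof.
apply: (@le_trans _ _ ((\1_(cube (rat_cube 0%N).1 (rat_cube 0%N).2) x)%:E *
                  cube_avg phi (rat_cube 0%N))).
  by apply: mule_ge0; [rewrite lee_fin|exact/cube_avg_ge0/rat_cube_gt0].
by apply: ereal_sup_ubound; exists 0%N.
Qed.

Lemma rat_maximal_weak_type (l : R) : (0 < l)%R ->
  mu [set x | l%:E < rat_maximal phi x] <=
  (2 * 3 ^+ n.+1 / l)%:E * \int[mu]_x (if l < 2 * phi x then phi x else 0)%:E.
Proof.
move=> l0.
(* A cube where [phi] has average above [l] carries an integral of at least
   [l / 2] times its volume of the part of [phi] above [l / 2]. *)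
pose psi (x : Rn R n) := (if l < 2 * phi x then phi x else 0)%R.
have psi0 x : (0 <= psi x)%R by rewrite /psi; case: ifP.
have mpsi : measurable_fun setT psi by exact: measurable_above_level.
pose good k := `[< l%:E < cube_avg phi (rat_cube k) >].
pose E k : set (Rn R n) :=
  if good k then cube (rat_cube k).1 (rat_cube k).2 else set0.
have mE k : measurable (E k) by rewrite /E; case: ifP => // _; exact: measurable_cube.
have subE : [set x | l%:E < rat_maximal phi x] `<=` \bigcup_k E k.
  move=> x /= /ereal_sup_gt[_ [k _ <-]]; rewrite indicE.
  have [kx|_] := boolP (x \in _); last first.
    by rewrite mul0e lte_fin ltNge (ltW l0).
  rewrite mul1e => lk; exists k => //; rewrite /E /good asboolT//.
  by rewrite inE in kx.
apply: (le_trans (le_lebesgue_outer subE)).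
apply: (measure_bigcup_le (mu := mu)) => // m.
pose s := [seq rat_cube k | k <- iota 0 m & good k].
have -> : \bigcup_(k < m) E k = cubes s.
  apply/seteqP; split => [x [k /= km]|x [b /= /mapP[k]]].
    rewrite /E; case: ifPn => // gk kx; exists (rat_cube k) => //=.
    by apply: map_f; rewrite mem_filter gk mem_iota.
  rewrite mem_filter mem_iota => /andP[gk km] -> kx; exists k => //.
  by rewrite /E gk.
apply: (@le_trans _ _ ((3 ^+ n.+1 / (l / 2))%:E * \int[mu]_(x in cubes s) (psi x)%:E)).
  apply: vitali_cubes => //; first by rewrite divr_gt0.
  move=> _ /mapP[k + ->]; rewrite mem_filter => /andP[/asboolP gk _].
  have r0 := rat_cube_gt0 k; split => //.
  set Q : set (Rn R n) := cube _ _.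
  have mQ : measurable Q by exact: measurable_cube.
  set v := ((2 * (rat_cube k).2) ^+ n.+1)%R.
  have v0 : (0 < v)%R by rewrite exprn_gt0// mulr_gt0.
  have h1 : (l * v)%:E < \int[mu]_(y in Q) (phi y)%:E.
    by rewrite mulrC EFinM -lte_pdivlMl.
  have h2 : \int[mu]_(y in Q) (phi y)%:E <=
      \int[mu]_(y in Q) (psi y)%:E + (l / 2 * v)%:E.
    apply: (@le_trans _ _ (\int[mu]_(y in Q) ((psi y)%:E + (l / 2)%:E))).
      apply: le_integral_nonmeas => y _; first by rewrite lee_fin.
      rewrite -EFinD lee_fin /psi; case: ltP => [_|]; last by lra.
      by rewrite lerDl divr_ge0// ltW.
    have psiE0 y : Q y -> 0 <= (psi y)%:E by move=> _; rewrite lee_fin.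
    have cstE0 y : Q y -> 0 <= (l / 2)%:E.
      by move=> _; rewrite lee_fin divr_ge0// ltW.
    have mpsiQ : measurable_fun Q (EFin \o psi).
      exact/measurable_funTS/measurable_EFinP.
    rewrite (ge0_integralD mu mQ psiE0 mpsiQ cstE0 (measurable_cst _)).
    apply: leeD => //; rewrite integral_cst// [leRHS]EFinM lee_wpmul2l//.
      by rewrite lee_fin divr_ge0// ltW.
    exact: leb_cube_le.
  rewrite leNgt; apply/negP => h3.
  have : \int[mu]_(y in Q) (phi y)%:E < (l * v)%:E.
    apply: (le_lt_trans h2); have -> : (l * v = l / 2 * v + l / 2 * v)%R by field.
    by rewrite EFinD lte_leD.
  by rewrite ltNge (ltW h1).
have -> : (3 ^+ n.+1 / (l / 2) = 2 * 3 ^+ n.+1 / l)%R.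
  by field; rewrite gt_eqF.
rewrite lee_wpmul2l ?lee_fin ?divr_ge0 ?mulr_ge0 ?exprn_ge0 ?(ltW l0)//.
apply: (@ge0_subset_integral _ (Rn R n) R mu _ _ (measurable_cubes _)
  measurableT (EFin \o psi)); last by [].
- exact/measurable_EFinP.
- by move=> x _; rewrite lee_fin.
Qed.

(** A cube of radius [r] lies in a rational cube of radius at most [2 * r]. *)
Lemma integral_cube_le_maximal x (r : R) : (0 < r)%R ->
  \int[mu]_(y in (cube x r : set (Rn R n))) (phi y)%:E <=
  ((4 * r) ^+ n.+1)%:E * rat_maximal phi x.
Proof.
move=> r0.
have [q qP] : {q : 'I_n.+1 -> rat & forall i, (`|x i 0 - ratr (q i)| < r / 2)%R}.
  apply: (@choice _ _ (fun i q => `|x i 0 - ratr q| < r / 2)%R) => i.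
  have [|q] := @rat_in_itvoo R (x i 0 - r / 2)%R (x i 0 + r / 2)%R.
    by have := r0; lra.
  rewrite in_itv/= => /andP[q1 q2]; exists q.
  by rewrite ltr_distl; apply/andP; split; lra.
have [|s] := @rat_in_itvoo R (3 / 2 * r)%R (2 * r)%R; first by have := r0; lra.
rewrite in_itv/= => /andP[s1 s2].
have s0 : (0 < s)%R by rewrite -(ltr0q R) (lt_trans _ s1)// mulr_gt0// divr_gt0.
have kE : rat_cube (pickle (\col_i q i : 'cV[rat]_n.+1, s)) =
    (map_mx ratr (\col_i q i), ratr s) by rewrite /rat_cube pickleK s0.
set k := pickle _ in kE.
have sub : cube x r `<=` cube (rat_cube k).1 (rat_cube k).2.
  move=> y xy i; rewrite kE/= !mxE; have := xy i; have := qP i; move: s1.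
  rewrite !ltr_distl => ? /andP[? ?] /andP[? ?].
  by apply/andP; split; lra.
have kx : cube (rat_cube k).1 (rat_cube k).2 x.
  by apply: sub => i; rewrite subrr normr0.
have v0 : (0 < (2 * (rat_cube k).2) ^+ n.+1)%R.
  by rewrite exprn_gt0// mulr_gt0// rat_cube_gt0.
apply: (@le_trans _ _ (((2 * (rat_cube k).2) ^+ n.+1)%:E * cube_avg phi (rat_cube k))).
  rewrite /cube_avg muleA -EFinM divff ?gt_eqF// mul1e.
  apply: (@ge0_subset_integral _ (Rn R n) R mu _ _ (measurable_cube _ _)
    (measurable_cube _ _) (EFin \o phi)); last exact: sub.
    exact/measurable_funTS/measurable_EFinP.
  by move=> y _; rewrite lee_fin.
apply: lee_pmul.
- by rewrite lee_fin ltW.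
- exact/cube_avg_ge0/rat_cube_gt0.
- rewrite lee_fin kE/=; apply: lerXn2r; rewrite ?nnegrE.
  + by rewrite mulr_ge0// ltW// (lt_trans _ s1)// mulr_gt0// divr_gt0.
  + by rewrite mulr_ge0// ltW.
  + by move: s2; lra.
- exact: rat_maximal_ubound.
Qed.

Lemma rat_maximal_ae_le (B : \bar R) : 0 <= B ->
  (\forall x \ae mu, (phi x)%:E <= B) -> forall x, rat_maximal phi x <= B.
Proof.
move=> B0 phiB x; apply: ge_ereal_sup => _ [k _ <-].
have r0 := rat_cube_gt0 k.
have v0 : (0 < (2 * (rat_cube k).2) ^+ n.+1)%R by rewrite exprn_gt0// mulr_gt0.
apply: (@le_trans _ _ (cube_avg phi (rat_cube k))).
  rewrite -[leRHS]mul1e lee_wpmul2r ?cube_avg_ge0// lee_fin indicE.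
  by case: (_ \in _).
rewrite /cube_avg lee_pdivrMl//.
set Q : set (Rn R n) := cube _ _.
have mQ : measurable Q by exact: measurable_cube.
apply: (@le_trans _ _ (\int[mu]_(y in Q) cst B y)).
  apply: ae_ge0_le_integral => //.
  - by move=> y _; rewrite lee_fin.
  - exact/measurable_funTS/measurable_EFinP.
  - by apply: filterS phiB => y + _.
rewrite integral_cst// muleC lee_wpmul2r//.
exact: leb_cube_le.
Qed.

End properties.
End maximal_function.

(** * Radially decreasing kernels *)

Section radial_kernel.
Context {R : realType} {n : nat}.
Local Notation V := 'cV[R]_n.+1.
Local Notation mu := (@leb R n).
Implicit Types (x y z : V) (r : R).
Local Open Scope ereal_scope.

Lemma leb_eball_fin : exists2 kap : R, mu (eball 0%R 1%R) = kap%:E & (0 <= kap)%R.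
Proof.
have le1 := leb_cube_le (0%R : V) (@ltr01 R).
have fin : mu (eball 0%R 1%R) \is a fin_num.
  rewrite ge0_fin_numE//; apply: le_lt_trans (ltry _).
  by apply: le_trans le1; apply: le_lebesgue_outer; exact: eball_sub_cube.
by exists (fine (mu (eball 0%R 1%R))); rewrite ?fineK// fine_ge0.
Qed.

(** The point at signed distance [t] from the origin on the first coordinate
    axis; it serves to read off the radial profile of [h]. *)
Definition axis (t : R) : V := (t *: delta_mx ord0 0)%R.

Lemma enorm_axis t : (0 <= t)%R -> enorm (axis t) = t.
Proof.
move=> t0; rewrite enormZ ger0_norm// /enorm (bigD1 ord0)//= big1.
  by rewrite mxE !eqxx expr1n addr0 sqrtr1 mulr1.
by move=> i /negPf i0; rewrite mxE i0 expr0n.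
Qed.

(** The inner radius of the [k]-th dyadic shell, whose outer radius is [2 ^+ k]:
    the shell of index [0] is the unit ball. *)
Definition inner_radius (k : nat) : R := (if k is j.+1 then 2 ^+ j else 0)%R.

Lemma inner_radius_ge0 k : (0 <= inner_radius k)%R.
Proof. by case: k => //= k; exact: exprn_ge0. Qed.

Lemma dyadic_shell z : exists k, (inner_radius k <= enorm z < 2 ^+ k)%R.
Proof.
have exP : exists k, (enorm z < 2 ^+ k)%R by exact: exp2_unbounded.
exists (ex_minn exP); case: ex_minnP => k -> kmin; rewrite andbT.
case: k kmin => [_|k kmin]; first exact: enorm_ge0.
by rewrite leNgt; apply/negP => /kmin; rewrite ltnn.
Qed.

(** The [k]-th dyadic shell. *)
Definition shell (k : nat) : set (Rn R n) :=
  eball (0%R : V) (2 ^+ k)%R `\` eball 0%R (inner_radius k).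

Lemma measurable_shell k : measurable (shell k).
Proof. by apply: measurableD; exact: measurable_eball. Qed.

Lemma trivIset_shell : trivIset setT shell.
Proof.
have disj k l x : (k < l)%N -> shell k x -> shell l x -> False.
  case: l => // l kl [xk _] [_]; apply.
  by move: xk; rewrite /eball/= => /lt_le_trans; apply; rewrite ler_eXn2l// ltr1n.
apply/trivIsetP => k l _ _ kl; apply/seteqP; split => // x [xk xl].
by case: (ltngtP k l) => [/disj/(_ xk xl)|/disj/(_ xl xk)|/eqP]//; rewrite (negPf kl).
Qed.

Lemma leb_shell_ge (kap : R) k : mu (eball 0%R 1%R) = kap%:E -> (0 <= kap)%R ->
  ((2 ^+ k) ^+ n.+1 * (kap / 2))%:E <= mu (shell k).
Proof.
move=> kapE kap0.
have e2 j : (0 < 2 ^+ j :> R)%R by rewrite exprn_gt0.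
have inner_le : mu (eball 0%R (inner_radius k)) <= ((2 ^+ k) ^+ n.+1 * (kap / 2))%:E.
  case: k => [|j]; rewrite /inner_radius.
    have -> : eball (0%R : V) 0 = set0.
      by apply/seteqP; split => // x; rewrite /eball/= ltNge enorm_ge0.
    by rewrite measure0 lee_fin !mulr_ge0 ?exprn_ge0// invr_ge0.
  rewrite leb_eball// kapE -EFinM lee_fin [(2 ^+ j.+1)%R]exprS exprMn.
  rewrite [leRHS](_ : _ = ((2 ^+ j) ^+ n.+1 * kap) * (2 ^+ n.+1 / 2))%R; last by ring.
  rewrite ler_peMr ?mulr_ge0 ?exprn_ge0//.
  by rewrite exprS mulrAC divff// mul1r exprn_ege1// ler1n.
have : mu (eball 0%R (2 ^+ k)%R) <= mu (shell k) + mu (eball 0%R (inner_radius k)).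
  apply: (@le_trans _ _ (mu (shell k `|` eball 0%R (inner_radius k)))).
    apply: le_lebesgue_outer => x xk.
    by have [?|?] := pselect (eball 0%R (inner_radius k) x); [right|left].
  exact: (@outer_measureU2 _ _ (lebesgue_outer_measure R n)).
rewrite leb_eball// kapE -EFinM => h1; rewrite leNgt; apply/negP => h2.
move: h1; rewrite leNgt => /negP; apply.
rewrite (_ : (_ * kap)%R = ((2 ^+ k) ^+ n.+1 * (kap / 2) +
  (2 ^+ k) ^+ n.+1 * (kap / 2))%R); last by field.
rewrite EFinD lte_leD// ge0_fin_numE//.
exact: le_lt_trans inner_le (ltry _).
Qed.

Context (h : V -> R) (h_ge0 : forall x, (0 <= h x)%R).
Context (h_decr : forall x y, (enorm x <= enorm y)%R -> (h y <= h x)%R).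
Context (mh : measurable_fun setT (h : Rn R n -> R)).
Context (h_int : \int[mu]_x (h x)%:E = 1).
Context (kap : R) (kapE : mu (eball 0%R 1%R) = kap%:E) (kap_gt0 : (0 < kap)%R).

(** The largest value of [h] on the [k]-th shell. *)
Definition weight (k : nat) : R := h (axis (inner_radius k)).

(** Up to a dimensional constant, the integral of the sum of the indicators of
    the balls of radius [2 ^+ k], weighted by [weight k]; this sum majorizes [h]. *)
Definition shell_sum : \bar R := \sum_(k <oo) (weight k * (2 ^+ k) ^+ n.+1)%:E.

Lemma shell_term_ge0 k : 0 <= (weight k * (2 ^+ k) ^+ n.+1)%:E.
Proof. by rewrite lee_fin mulr_ge0 ?h_ge0// !exprn_ge0. Qed.

Lemma shell_sum_ge0 : 0 <= shell_sum.
Proof. by apply: nneseries_ge0 => k _ _; exact: shell_term_ge0. Qed.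

(** The weight of a shell bounds [h] from below on the previous shell, which has
    comparable measure. *)
Lemma shell_term_le k : (weight k.+1 * (2 ^+ k.+1) ^+ n.+1)%:E <=
  (2 ^+ n.+1 * 2 / kap)%:E * \int[mu]_(x in shell k) (h x)%:E.
Proof.
have C0 : (0 <= 2 ^+ n.+1 * 2 / kap)%R by rewrite divr_ge0 ?mulr_ge0 ?exprn_ge0// ltW.
apply: (@le_trans _ _ ((2 ^+ n.+1 * 2 / kap)%:E *
    ((weight k.+1)%:E * mu (shell k)))).
  apply: (@le_trans _ _ ((2 ^+ n.+1 * 2 / kap)%:E *
    ((weight k.+1)%:E * ((2 ^+ k) ^+ n.+1 * (kap / 2))%:E))).
    rewrite -!EFinM lee_fin le_eqVlt; apply/orP; left; apply/eqP.
    by rewrite [(2 ^+ k.+1)%R]exprS exprMn; field; rewrite gt_eqF.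
  rewrite lee_wpmul2l ?lee_fin// lee_wpmul2l ?lee_fin ?h_ge0//.
  by apply: leb_shell_ge => //; exact: ltW.
rewrite lee_wpmul2l ?lee_fin// -(@integral_cst _ _ _ mu _ (measurable_shell k)).
apply: le_integral_nonmeas => x; first by move=> _; rewrite lee_fin; exact: h_ge0.
rewrite /shell /eball/= subr0 => -[xk _]; rewrite lee_fin; apply: h_decr.
by rewrite enorm_axis ?inner_radius_ge0// ltW.
Qed.

Lemma shell_sum_lty : shell_sum < +oo.
Proof.
rewrite /shell_sum nneseries_recl//; last by move=> k _; exact: shell_term_ge0.
rewrite -(@nneseries_addn _ _ 1%N); last exact: shell_term_ge0.
under eq_eseriesr do rewrite addn1.
apply: lte_add_pinfty; first exact: ltry.
apply: (@le_lt_trans _ _ (\sum_(k <oo) (2 ^+ n.+1 * 2 / kap)%:E *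
    \int[mu]_(x in shell k) (h x)%:E)).
  apply: lee_nneseries => k _; first by move=> _; exact: shell_term_ge0.
  exact: shell_term_le.
have mhE : measurable_fun setT (EFin \o h : Rn R n -> \bar R) by exact/measurable_EFinP.
have mS : measurable (\bigcup_k shell k).
  by apply: bigcupT_measurable => k; exact: measurable_shell.
rewrite nneseriesZl; last by move=> k _; apply: integral_ge0 => x _; rewrite lee_fin.
rewrite -(ge0_integral_bigcup mu (f := EFin \o h) measurable_shell); last 3 first.
- exact: measurable_funTS.
- by move=> x _; rewrite lee_fin.
- exact: trivIset_shell.
apply: (@le_lt_trans _ _ ((2 ^+ n.+1 * 2 / kap)%:E * 1)); last by rewrite mule1 ltry.
rewrite lee_wpmul2l//.
  by rewrite lee_fin divr_ge0 ?mulr_ge0 ?exprn_ge0// ltW.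
rewrite -h_int; apply: (@ge0_subset_integral _ (Rn R n) R mu _ _ mS measurableT
  (EFin \o h) mhE); last by [].
by move=> x _; rewrite lee_fin.
Qed.

Lemma dilate_le_shells (e : R) z : (0 < e)%R -> exists k,
  (dilate h e z <= e ^- n.+1 * weight k)%R /\ (enorm z < e * 2 ^+ k)%R.
Proof.
move=> e0; have [k /andP[k1 k2]] := dyadic_shell (e^-1 *: z)%R.
exists k; split.
  rewrite /dilate ler_wpM2l ?invr_ge0 ?exprn_ge0 ?(ltW e0)//; apply: h_decr.
  by rewrite enorm_axis ?inner_radius_ge0.
by rewrite mulrC -ltr_pdivrMr// mulrC; rewrite enormZ gtr0_norm ?invr_gt0 in k2.
Qed.

(** Averages against the dilates of [h] are dominated by the maximal function.
    The factor [b] leaves room for the normalization of the Markovian kernel. *)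
Lemma kern_integral_le (D : set (Rn R n)) (phi : Rn R n -> R) (g : V -> R) (b e : R) x :
  measurable_fun setT phi -> (forall y, 0 <= phi y)%R ->
  (0 <= b)%R -> (0 < e)%R ->
  (forall y, D y -> `|g y| <= b * (kern h e x y * phi y))%R ->
  `|\int[mu]_(y in D) (g y)%:E| <=
    (b * 4 ^+ n.+1)%:E * shell_sum * rat_maximal phi x.
Proof.
move=> mphi phi0 b0 e0 gb.
have M0 := rat_maximal_ge0 phi0 x.
pose B k : set (Rn R n) := cube x (e * 2 ^+ k)%R.
have mB k : measurable (B k) by exact: measurable_cube.
have a0 k : (0 <= b * (e ^- n.+1 * weight k))%R.
  by rewrite mulr_ge0// mulr_ge0 ?h_ge0// invr_ge0 exprn_ge0// ltW.
have phiE0 y : 0 <= (phi y)%:E by rewrite lee_fin.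
have mphiE : measurable_fun setT (EFin \o phi) by exact/measurable_EFinP.
have mphiB k : measurable_fun setT ((EFin \o phi) \_ (B k)).
  apply: (measurable_restrictT (EFin \o phi) (mB k)).1.
  exact: measurable_funTS mphiE.
have F0 k y : 0 <= ((EFin \o phi) \_ (B k)) y.
  by apply: erestrict_ge0 => z _; exact: phiE0.
pose term k (y : Rn R n) :=
  (b * (e ^- n.+1 * weight k))%:E * ((EFin \o phi) \_ (B k)) y.
have term0 k y : 0 <= term k y by apply: mule_ge0; rewrite ?lee_fin.
have mterm k : measurable_fun setT (term k) by exact: measurable_funeM (mphiB k).
pose G y := \sum_(k <oo) term k y.
have G0 y : 0 <= G y by exact: nneseries_ge0.
apply: (@le_trans _ _ (\int[mu]_(y in D) G y)).
  apply: abse_integral_le => y Dy; rewrite abse_EFin.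
  have [k [k1 k2]] := dilate_le_shells (y - x)%R e0.
  apply: (@le_trans _ _ (term k y)).
    rewrite /term patchE mem_set; last exact: eball_sub_cube.
    rewrite -EFinM lee_fin (le_trans (gb _ Dy))// -[leRHS]mulrA ler_wpM2l//.
    by rewrite ler_wpM2r.
  by rewrite /G (@nneseriesD1 _ _ k)// leeDl//; exact: nneseries_ge0.
apply: (@le_trans _ _ (\int[mu]_y G y)).
  rewrite integral_mkcond; apply: le_integral_nonmeas => y _.
    by apply: erestrict_ge0 => z _; exact: G0.
  by rewrite patchE; case: ifP.
rewrite (@integral_nneseries _ (Rn R n) R mu setT measurableT term mterm);
  last by move=> k y _; exact: term0.
apply: lime_le.
  by apply: is_cvg_nneseries => k _ _; apply: integral_ge0 => y _; exact: term0.
apply: nearW => m.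
apply: (@le_trans _ _ (\sum_(0 <= k < m)
    (b * 4 ^+ n.+1)%:E * (weight k * (2 ^+ k) ^+ n.+1)%:E * rat_maximal phi x)).
  apply: lee_sum => k _.
  rewrite (ge0_integralZl mu measurableT (mphiB k)); last 2 first.
  - by move=> y _; exact: F0.
  - by rewrite lee_fin.
  rewrite -integral_mkcond.
  have ek : (0 < e * 2 ^+ k)%R by rewrite mulr_gt0// exprn_gt0.
  apply: (le_trans (lee_wpmul2l _ (integral_cube_le_maximal mphi phi0 x ek))).
    by rewrite lee_fin.
  rewrite muleA -!EFinM lee_wpmul2r// lee_fin le_eqVlt; apply/orP; left; apply/eqP.
  by rewrite !exprMn; field; rewrite expf_neq0// gt_eqF.
have b4 : 0 <= (b * 4 ^+ n.+1)%:E by rewrite lee_fin mulr_ge0// exprn_ge0.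
rewrite -ge0_sume_distrl; last first.
  by move=> k _; apply: mule_ge0 => //; exact: shell_term_ge0.
rewrite lee_wpmul2r// -ge0_sume_distrr; last by move=> k _; exact: shell_term_ge0.
rewrite lee_wpmul2l//.
by apply: nneseries_lim_ge => k _ _; exact: shell_term_ge0.
Qed.

(** Otherwise [h] would vanish away from the origin, and its integral would be at
    most [h 0] times the measure of arbitrarily small balls. *)
Lemma h_positive_near0 : exists r a, [/\ (0 < r <= 1)%R, (0 < a)%R &
  forall z, (enorm z < r)%R -> (a <= h z)%R].
Proof.
have [[z z0 hz]|hall] := pselect (exists2 z, (0 < enorm z)%R & (0 < h z)%R).
  exists (Num.min 1 (enorm z))%R, (h z); split => //.
  - by rewrite lt_min ltr01 z0 ge_min lexx.
  - move=> y; rewrite lt_min => /andP[_ yz]; apply: h_decr; exact: ltW.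
exfalso.
have h0 := h_ge0 0%R.
have hk0 : (0 <= h 0 * kap)%R by rewrite mulr_ge0// ltW.
pose s : R := (h 0 * kap + 1)^-1%R.
have s0 : (0 < s)%R by rewrite invr_gt0 ltr_wpDl.
have s1 : (s <= 1)%R by rewrite invf_le1 ?ltr_wpDl// lerDr.
have : \int[mu]_x (h x)%:E <= \int[mu]_(x in eball (0%R : V) s) (h 0%R)%:E.
  rewrite [leRHS]integral_mkcond; apply: le_integral_nonmeas => x _.
    by rewrite lee_fin.
  have e0 : enorm (0%R : V) = 0%R by rewrite -(scale0r 0) enormZ normr0 mul0r.
  rewrite patchE; have [xs|xs] := boolP (x \in _).
    by rewrite lee_fin; apply: h_decr; rewrite e0 enorm_ge0.
  rewrite lee_fin leNgt; apply/negP => hx; apply: hall; exists x => //.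
  rewrite lt_neqAle enorm_ge0 andbT; apply/eqP => x0; move/negP: xs; apply.
  by rewrite inE /eball/= subr0 -x0.
rewrite integral_cst; last exact: measurable_eball.
rewrite h_int leb_eball// kapE -!EFinM lee_fin leNgt => /negP; apply.
apply: (@le_lt_trans _ _ (h 0 * kap * s)%R).
  rewrite [leRHS]mulrAC [leLHS]mulrA ler_wpM2r ?(ltW kap_gt0)// ler_wpM2l//.
  by rewrite exprS ler_piMr ?(ltW s0)// exprn_ile1// ltW.
rewrite /s -[ltRHS](@divff _ (h 0 * kap + 1)%R) ?gt_eqF ?ltr_wpDl//.
by rewrite ltr_pM2r ?ltrDl// invr_gt0 ltr_wpDl.
Qed.

End radial_kernel.

(** * The Markovian normalization *)

Section markov_maximal.
Context {R : realType} {n : nat}.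
Local Notation V := 'cV[R]_n.+1.
Local Notation mu := (@leb R n).
Local Open Scope ereal_scope.

(** The mass is bounded below on [Omega].  If the kernel had infinite integral,
    [mass] would be [0] by convention, and so would its inverse, so the bound does
    not depend on integrability. *)
Lemma mass_inv_le (h : V -> R) (Omega : set V) (eps0 c r a kap e : R) (x : V) :
  measurable (Omega : set (Rn R n)) ->
  (forall x, 0 <= h x)%R -> (0 < c)%R -> (0 < r <= 1)%R -> (0 < a)%R ->
  (forall e x, (0 < e < eps0)%R -> Omega x ->
    c%:E * mu (eball x e) < mu (eball x e `&` Omega)) ->
  (forall z, (enorm z < r)%R -> (a <= h z)%R) ->
  mu (eball 0%R 1%R) = kap%:E -> (0 < kap)%R -> (0 < e < eps0)%R -> Omega x ->
  (0 <= (mass h Omega e x)^-1 <= (a * c * r ^+ n.+1 * kap)^-1)%R.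
Proof.
move=> mOmega h_ge0 c0 /andP[r0 r1] a0 thickc ha kapE kap0 /andP[e0 ee] Ox.
set L := (a * c * r ^+ n.+1 * kap)%R.
have L0 : (0 < L)%R by rewrite !mulr_gt0// exprn_gt0.
have en0 : (0 <= e ^- n.+1)%R by rewrite invr_ge0 exprn_ge0// ltW.
have re0 : (0 < r * e)%R by rewrite mulr_gt0.
have kern0 y : (0 <= kern h e x y)%R by rewrite mulr_ge0.
have : L%:E <= \int[mu]_(y in (Omega : set (Rn R n))) (kern h e x y)%:E.
  pose B : set (Rn R n) := eball x (r * e)%R `&` Omega.
  have mB : measurable B by apply: measurableI => //; exact: measurable_eball.
  apply: (@le_trans _ _ (\int[mu]_(y in B) cst (e ^- n.+1 * a)%:E y)).
    rewrite integral_cst//.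
    have ree : (0 < r * e < eps0)%R.
      by rewrite re0/= (le_lt_trans _ ee)// ler_piMl// ltW.
    apply: (@le_trans _ _ ((e ^- n.+1 * a)%:E * (c%:E * mu (eball x (r * e)%R)))).
      rewrite leb_eball// kapE -!EFinM lee_fin le_eqVlt; apply/orP; left; apply/eqP.
      by rewrite /L exprMn; field; rewrite expf_neq0// gt_eqF.
    rewrite lee_wpmul2l//; first by rewrite lee_fin mulr_ge0// ltW.
    by apply: ltW; exact: thickc.
  rewrite integral_mkcond [leRHS]integral_mkcond.
  apply: le_integral_nonmeas => y _.
    by apply: erestrict_ge0 => z _; rewrite lee_fin mulr_ge0// ltW.
  rewrite !patchE; case: ifPn => [/set_mem[yB yO]|_].
    rewrite mem_set// lee_fin /kern /dilate ler_wpM2l//; apply: ha.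
    by rewrite enormZ gtr0_norm ?invr_gt0// mulrC ltr_pdivrMr.
  by case: ifP => // _; rewrite lee_fin.
rewrite /mass /Rintegral; case: (integral _ _ _) => [v||//] /=.
  rewrite lee_fin => Lv; have v0 : (0 < v)%R by exact: lt_le_trans Lv.
  by rewrite invr_ge0 (ltW v0)/= lef_pV2.
by move=> _; rewrite invr0 lexx/= invr_ge0 ltW.
Qed.

End markov_maximal.

Theorem proposition3p5 (R : realType) (n : nat)
  (Omega : set 'cV[R]_n.+1) (Omega_thick : thick Omega) (Omega_open : open Omega)
  (eps0 : R) (eps0_scale : thick_scale Omega eps0)
  (h : 'cV[R]_n.+1 -> R) (h_L1 : h \in Lfun (@leb R n) 1)
  (h_ge0 : forall x, 0 <= h x)
  (h_radial : forall (O : 'M[R]_n.+1) (x : 'cV[R]_n.+1),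
     O^T *m O = 1%:M -> h (O *m x) = h x)
  (h_norm : ('N[@leb R n]_1[EFin \o h] = 1)%E)
  (h_decr : forall x y, enorm x <= enorm y -> h y <= h x)
  (p : \bar R) (p_gt1 : (1 < p)%E) :
  exists A : R, 0 < A /\
    forall f : 'cV[R]_n.+1 -> R, Lspace_on Omega p f ->
      (Lnorm_on Omega p (maximal_fun h Omega eps0 f)
       <= A%:E * Lnorm_on Omega p (EFin \o f))%E.
Proof.
have [mOmega _] := Omega_thick.
have [eps0_gt0 [c c0 thickc]] := eps0_scale.
have p0 : (p != 0)%E by rewrite gt_eqF// (lt_trans _ p_gt1)// lte01.
have [->|/set0P[x0 Ox0]] := eqVneq Omega set0.
  exists 1; split => // f _; rewrite /Lnorm_on mul1e.
  rewrite (_ : maximal_fun _ _ _ _ \_ _ = cst 0%E); last by rewrite patch_set0.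
  by rewrite Lnorm0// Lnorm_ge0.
have mh : measurable_fun setT (h : Rn R n -> R).
  by have /andP[/= + _] := h_L1; rewrite inE.
have h_int : (\int[@leb R n]_x (h x)%:E = 1)%E.
  by rewrite -h_norm Lnorm1; apply: eq_integral => x _ /=; rewrite ger0_norm.
have [kap kapE kap_ge0] := @leb_eball_fin R n.
(* If the unit ball were null, so would be all balls, against the strict
   inequality in the definition of thickness. *)
have kap0 : 0 < kap.
  rewrite lt_neqAle kap_ge0 andbT; apply/eqP => kap_eq0.
  have e2 : 0 < eps0 / 2 < eps0.
    by rewrite divr_gt0//= ltr_pdivrMr// ltr_pMr// ltr1n.
  have := thickc _ _ e2 Ox0; rewrite leb_eball ?divr_gt0// kapE -kap_eq0 !mule0.
  have : (leb (eball x0 (eps0 / 2) `&` Omega) <= leb (eball x0 (eps0 / 2)))%E.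
    by apply: le_lebesgue_outer; exact: subIsetl.
  rewrite leb_eball ?divr_gt0// kapE -kap_eq0 mule0 => le0 lt0.
  by have := lt_le_trans lt0 le0; rewrite ltxx.
have [r [a [r01 a0 ha]]] := h_positive_near0 h_ge0 h_decr h_int kapE kap0.
pose b := (a * c * r ^+ n.+1 * kap)^-1.
have b0 : 0 <= b.
  by rewrite invr_ge0 !mulr_ge0 ?exprn_ge0 ?(ltW a0) ?(ltW c0)//; case/andP: r01 => /ltW.
have S_lty := shell_sum_lty h_ge0 h_decr mh h_int kapE kap0.
have S_ge0 := shell_sum_ge0 h_ge0.
pose A := b * 4 ^+ n.+1 * fine (shell_sum h).
have A0 : 0 <= A by rewrite !mulr_ge0 ?exprn_ge0// fine_ge0.
have AE : (A%:E = (b * 4 ^+ n.+1)%:E * shell_sum h)%E.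
  by rewrite EFinM fineK// ge0_fin_numE.
have domination (f : 'cV[R]_n.+1 -> R) x :
    measurable_fun setT (f \_ Omega : Rn R n -> R) -> Omega x ->
    (0 <= maximal_fun h Omega eps0 f x
       <= A%:E * rat_maximal (fun y => `|(f \_ Omega) y|%R) x)%E.
  move=> mf Ox.
  have mphi : measurable_fun setT (fun y : Rn R n => `|(f \_ Omega) y|).
    exact: (measurableT_comp (@normr_measurable R setT) mf).
  apply/andP; split.
    have e2 : 0 < eps0 / 2 < eps0.
      by rewrite divr_gt0//= ltr_pdivrMr// ltr_pMr// ltr1n.
    apply: le_trans (ereal_sup_ubound _); last by exists (eps0 / 2).
    exact: abse_ge0.
  apply: ge_ereal_sup => _ [e /= ee <-]; rewrite AE.
  have /andP[e0 _] := ee.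
  apply: (kern_integral_le h_ge0 h_decr mphi _ b0 e0) => // y Oy.
  have /andP[m0 mb] := mass_inv_le mOmega h_ge0 c0 r01 a0 thickc ha kapE kap0 ee Ox.
  have k0 : 0 <= kern h e x y by rewrite mulr_ge0// invr_ge0 exprn_ge0// ltW.
  rewrite /markov_kern patchE mem_set// 2!normrM (ger0_norm k0) (ger0_norm m0).
  rewrite [leLHS]mulrAC [leLHS]mulrC; apply: ler_wpM2r => //.
  by rewrite mulr_ge0.
case: p p_gt1 p0 => [q q1 _|_ _|//]; last first.
  (* Adding [1] only makes the constant positive. *)
  exists (A + 1); split => [|f fL]; first by rewrite ltr_wpDl.
  have mf : measurable_fun setT (f \_ Omega : Rn R n -> R).
    have /andP[/= + _] : f \_ Omega \in Lfun (@leb R n) +oo%E := fL.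
    by rewrite inE.
  rewrite /Lnorm_on unlock; case: ifPn => muT; last by rewrite mule0.
  set N := (X in (_ <= _ * X)%E).
  have N0 : (0 <= N)%E.
    by apply: ess_sup_gee => //; apply/nearW => x; exact: abse_ge0.
  have NE : N = ess_sup (@leb R n) (fun y => `|(f \_ Omega) y|%:E).
    by congr ess_sup; apply/funext => y /=; rewrite !patchE; case: ifP.
  apply/ess_supP/nearW => x /=; rewrite patchE; case: ifPn => [/set_mem Ox|_]; last first.
    by rewrite abse0 mule_ge0// lee_fin addr_ge0.
  have /andP[M0 MA] := domination f x mf Ox.
  rewrite gee0_abs// (le_trans MA)//.
  apply: (@le_trans _ _ (A%:E * N)%E); last by rewrite lee_wpmul2r// lee_fin lerDl.
  rewrite lee_wpmul2l// ?lee_fin//.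
  have mphi : measurable_fun setT (fun y : Rn R n => `|(f \_ Omega) y|).
    exact: (measurableT_comp (@normr_measurable R setT) mf).
  apply: (rat_maximal_ae_le mphi (fun y => normr_ge0 _) N0).
  by rewrite NE; exact: ess_sup_ge.
rewrite lte_fin in q1.
pose K : R := 2 * 3 ^+ n.+1 * 2 `^ q * (2 `^ (q - 1) / (1 - 2^-1 `^ (q - 1))).
have K0 : 0 <= K.
  have q1' : 2^-1 `^ (q - 1) < 1 :> R by apply: half_powR_lt1; rewrite subr_gt0.
  by rewrite !mulr_ge0 ?powR_ge0 ?exprn_ge0// invr_ge0 subr_ge0 ltW.
exists ((A `^ q * K) `^ q^-1 + 1); split.
  by rewrite ltr_wpDl// powR_ge0.
move=> f fL.
have mf : measurable_fun setT (f \_ Omega : Rn R n -> R).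
  have /andP[/= + _] : f \_ Omega \in Lfun (@leb R n) q%:E := fL.
  by rewrite inE.
pose phi (y : Rn R n) := `|(f \_ Omega) y|.
have mphi : measurable_fun setT phi.
  exact: (measurableT_comp (@normr_measurable R setT) mf).
have phi0 y : 0 <= phi y by exact: normr_ge0.
have mM := measurable_rat_maximal phi.
have M0 := rat_maximal_ge0 phi0.
apply: (@le_trans _ _ ('N[@leb R n]_q%:E[(fun x => A%:E * rat_maximal phi x)])%E).
  apply: le_Lnorm_nonmeas => [|x]; first by rewrite lee_fin ltW.
  rewrite [leRHS]gee0_abs; last by rewrite mule_ge0// lee_fin.
  rewrite patchE; case: ifPn => [/set_mem Ox|_]; last first.
    by rewrite abse0 mule_ge0// lee_fin.
  by have /andP[? ?] := domination f x mf Ox; rewrite gee0_abs.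
apply: (@le_trans _ _ (((A `^ q * K) `^ q^-1)%:E * 'N[@leb R n]_q%:E[EFin \o phi])%E).
  apply: Lnorm_scale_le => //.
  apply: (weak_type_integral_poweR q1 _ mphi phi0 mM M0
    (fun l l0 => rat_maximal_weak_type mphi phi0 l0)).
  by rewrite mulr_ge0// exprn_ge0.
have -> : ('N[@leb R n]_q%:E[EFin \o phi] = Lnorm_on Omega q%:E (EFin \o f))%E.
  rewrite /Lnorm_on -[RHS]Lnorm_abse; apply: eq_Lnorm => y /=; rewrite /phi !patchE.
  by case: ifP.
by rewrite lee_wpmul2r ?Lnorm_ge0// lee_fin lerDl.
Qed.
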